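(* Let $G$ be a graph and let $F:V(G)\to 2^{\mathbb{N}}$ be such that for each $v\in V(G)$: all holes of $v$ have size at most two; between any pair of distinct holes of $v$ is a home of size at least $3$; and both end-intervals of $v$ are homes of size at least two. Then $G$ admits an $F$-avoiding orientation.
   Context: All graphs are finite and loopless; parallel edges are permitted, and the degree $d(v)$ of a vertex $v$ of $G$ counts edges with multiplicity. $\mathbb{N}$ includes $0$, and $2^{\mathbb{N}}$ is the set of all subsets of $\mathbb{N}$. For each vertex $v$, the set $\{0,\ldots,d(v)\}$ is partitioned into maximal intervals (of consecutive integers) contained in $F(v)$, called the holes of $v$, and maximal intervals disjoint from $F(v)$, called the homes of $v$. The size of a hole or home is its number of elements. The end-intervals of $v$ are those holes or homes containing $0$ or $d(v)$; each vertex has two end-intervals, which need not be distinct. An orientation $D$ of $G$ assigns a direction to each edge, so that each edge points out of one endpoint and into the other; $d_D^+(v)$ is the number of edges pointing out of $v$. The orientation $D$ is $F$-avoiding if $d_D^+(v)\notin F(v)$ for all $v\in V(G)$. *)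

(* Defs.v *)
From mathcomp Require Import all_boot.
From mathcomp Require Import boolp classical_sets.

Set Implicit Arguments.
Unset Strict Implicit.
Unset Printing Implicit Defensive.

(* [ends e] is the set of the two distinct endpoints of [e], so there are no
   loops; [ends] need not be injective, so parallel edges are allowed. *)
Record multigraph := Multigraph {
  vertex : finType;
  edge : finType;
  ends : edge -> {set vertex};
  card_ends : forall e, #|ends e| = 2
}.

Definition degree (G : multigraph) (v : vertex G) : nat :=
  #|[pred e : edge G | v \in ends e]|.

Record orientation (G : multigraph) := Orientation {
  tail : edge G -> vertex G;
  head : edge G -> vertex G;
  ends_tail_head : forall e, ends e = [set tail e; head e]%SET
}.

Definition outdegree (G : multigraph) (D : orientation G) (v : vertex G) : nat :=
  #|[pred e : edge G | tail D e == v]|.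

Definition avoiding (G : multigraph) (F : vertex G -> set nat)
    (D : orientation G) : Prop :=
  forall v, outdegree D v \notin F v.

(* Intervals are nonempty; subsets of {0, ..., n} are of type {set 'I_n.+1}. *)
Definition is_interval n (I : {set 'I_n}) : bool :=
  [exists a : 'I_n, exists b : 'I_n,
    (a <= b) && (I == [set k : 'I_n | a <= k <= b]%SET)].

Section HolesAndHomes.
Variables (G : multigraph) (F : vertex G -> set nat) (v : vertex G).
Implicit Types I J H : {set 'I_(degree v).+1}.

Definition forbidden : {set 'I_(degree v).+1} :=
  [set k : 'I_(degree v).+1 | (k : nat) \in F v]%SET.

Definition is_hole I : bool :=
  maxset (fun J => is_interval J && (J \subset forbidden)) I.

Definition is_home I : bool :=
  maxset (fun J => is_interval J && [disjoint J & forbidden]) I.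

Definition is_end_interval I : bool :=
  (is_hole I || is_home I) && ((ord0 \in I) || (ord_max \in I)).

End HolesAndHomes.

Definition precedes n (I J : {set 'I_n}) : Prop :=
  forall i j : 'I_n, i \in I -> j \in J -> i < j.

Definition between n (H I J : {set 'I_n}) : Prop :=
  (precedes I H /\ precedes H J) \/ (precedes J H /\ precedes H I).

(* Main.v *)
Require Import Defs.
From mathcomp Require Import all_boot.
From mathcomp Require Import boolp classical_sets.
From mathcomp Require Import zify.

(** Give every possible outdegree of a vertex a cost: 3 if it is forbidden, 1 if
it is allowed but adjacent to a forbidden value, 0 otherwise.  An orientation D
of minimal total cost avoids all forbidden values, for the following reason.

The hypotheses say that two forbidden values at a vertex are either consecutive
or at distance at least 4, and that 0, 1, d - 1 and d are allowed
([spaced_forbidden]).  Suppose that in D the outdegree of v is forbidden.  Up to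
reversing all edges, the value just below it is allowed.  Reversing a directed
path from v to another vertex u lowers the outdegree of v, which saves 2, and
raises that of u.  By minimality the cost at u rises by at least 2, so u sits at
the top of a home, just below a hole ([descendant_top_of_home]).  Hence all
vertices reachable from v have positive outdegree, and a maximal directed path
from v closes up into a lasso: a path from v to some y, continued to some l, and
an edge from l back to y ([lasso]).  Now reverse the path from v to y and the
edge from l to y.  The first reversal only moves the defect from v to y, at no
change in cost.  The second one keeps the cost of y at most 3, and pushes l from
the top of its home to the value below, of cost 0 because a home between two
holes has at least three elements and the home containing 0 at least two.  The
total cost has dropped by at least 1, a contradiction
([minimal_no_bottom_of_hole]). *)

Set Implicit Arguments.
Unset Strict Implicit.
Unset Printing Implicit Defensive.

(** * Spaced sets of forbidden values *)

(** This single arithmetic condition is all that the argument uses of the sizes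
of the holes and homes of a vertex of degree [d], and it is invariant under
[k |-> d - k]. *)
Definition spaced (d : nat) (bad : pred nat) : Prop :=
  (forall i, bad i -> 1 < i /\ i + 2 <= d) /\
  (forall i j, bad i -> bad j -> i < j -> j = i.+1 \/ i + 4 <= j).

(** The forbidden outdegrees after all edges have been reversed. *)
Definition mirror (d : nat) (bad : pred nat) : pred nat :=
  fun k => (k <= d) && bad (d - k).

(** The weight 3 is chosen so that entering or leaving a hole changes the cost by
exactly 2, and moving inside a home by at most 1.  Truncation of [k.-1] at
[k = 0] is harmless, since 0 is not forbidden. *)
Definition cost (bad : pred nat) (k : nat) : nat :=
  if bad k then 3 else (bad k.+1 || bad k.-1 : nat).

Lemma spaced_mirror d bad : spaced d bad -> spaced d (mirror d bad).
Proof.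
move=> [ends sep]; split=> [i /andP[led /ends] | i j]; first by lia.
move=> /andP[lei badi] /andP[lej badj] ltij.
by case: (sep _ _ badj badi); lia.
Qed.

Lemma cost_mirror d bad k :
  spaced d bad -> k <= d -> cost (mirror d bad) k = cost bad (d - k).
Proof.
move=> [ends _] lekd; rewrite /cost /mirror lekd /=.
case: ifP => // _; congr (nat_of_bool _).
have bad0 : bad 0 = false by apply/negP => /ends; lia.
have badd : bad d = false by apply/negP => /ends; lia.
have badS : bad d.+1 = false by apply/negP => /ends; lia.
rewrite subnS (leq_trans (leq_pred k) lekd) /= orbC; congr (_ || _).
- case: k lekd => [|k] lekd /=; first by rewrite subn0 badd badS.
  by congr bad; lia.
- by case: ltngtP lekd => // -> _; rewrite subnn bad0.
Qed.

Lemma cost_le3 bad k : cost bad k <= 3.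
Proof. by rewrite /cost; case: ifP => // _; case: (_ || _). Qed.

Lemma cost_bottom_of_hole d bad k : spaced d bad -> bad k -> ~~ bad k.-1 ->
  cost bad k = 3 /\ cost bad k.-1 = 1.
Proof.
move=> [ends _] badk Nbad; have [k1 _] := ends _ badk.
by rewrite /cost badk (negPf Nbad) prednK ?badk //; lia.
Qed.

Lemma cost_jump bad k :
  cost bad k + 2 <= cost bad k.+1 -> ~~ bad k /\ bad k.+1.
Proof.
rewrite /cost; case: (bad k.+1); case: (bad k) => //=.
  by case: (bad k.+2).
by case: (bad k.-1); case: (bad k.+2).
Qed.

(** Descending from the top of a home is free of cost: the value below it is not
next to the previous hole, as forbidden values that are not consecutive lie at
distance at least 4. *)
Lemma cost_top_of_home d bad k : spaced d bad -> ~~ bad k -> bad k.+1 ->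
  [/\ 0 < k, cost bad k = 1, cost bad k.-1 = 0 & cost bad k.+1 = 3].
Proof.
move=> [ends sep] Nbad badS; have [k0 _] := ends _ badS.
have Nbad1 : bad k.-1 = false.
  by apply/negP => bad1; have := sep _ _ bad1 badS; lia.
have Nbad2 : bad k.-1.-1 = false.
  by apply/negP => bad2; have := sep _ _ bad2 badS; lia.
rewrite /cost badS (negPf Nbad) Nbad1 Nbad2 prednK ?(negPf Nbad) //; lia.
Qed.

(** * Reversing edges of an orientation *)

Definition arc (G : multigraph) (D : orientation G) : rel (vertex G) :=
  [rel x y | [exists e, (tail D e == x) && (Defs.head D e == y)]].

Lemma tail_neq_head (G : multigraph) (D : orientation G) e :
  tail D e != Defs.head D e.
Proof.
apply/eqP => eq_th; have := card_ends e.
by rewrite (ends_tail_head D) eq_th finset.setUid cards1.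
Qed.

Lemma arc_irreflexive (G : multigraph) (D : orientation G) :
  irreflexive (arc D).
Proof.
move=> x; apply/existsP => -[e /andP[/eqP te /eqP he]].
by have := tail_neq_head D e; rewrite te he eqxx.
Qed.

Lemma outdegree_gt0 (G : multigraph) (D : orientation G) x :
  0 < outdegree D x -> exists y, arc D x y.
Proof.
case/card_gt0P=> e te; exists (Defs.head D e).
by apply/existsP; exists e; rewrite eqxx andbT.
Qed.

Lemma ends_flip (G : multigraph) (D : orientation G) (R : pred (edge G)) e :
  ends e = [set if R e then Defs.head D e else tail D e;
                if R e then tail D e else Defs.head D e]%SET.
Proof. by rewrite (ends_tail_head D); case: (R e); rewrite // finset.setUC. Qed.

Definition flip (G : multigraph) (D : orientation G) (R : pred (edge G)) :
  orientation G := Orientation (ends_flip D R).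

Lemma outdegreeE (G : multigraph) (D : orientation G) x :
  outdegree D x = \sum_e (x == tail D e).
Proof.
rewrite /outdegree -sum1_card big_mkcond /=.
by apply: eq_bigr => e _; rewrite inE eq_sym; case: eqP.
Qed.

Definition transfers (G : multigraph) (D D1 : orientation G) a b : Prop :=
  forall x, outdegree D1 x + (x == a) = outdegree D x + (x == b).

Lemma transfers_source (G : multigraph) (D D1 : orientation G) a b :
  transfers D D1 a b -> a != b -> outdegree D1 a = (outdegree D a).-1.
Proof. by move=> /(_ a) + /negPf ab; rewrite eqxx ab addn0 addn1 => <-. Qed.

Lemma transfers_target (G : multigraph) (D D1 : orientation G) a b :
  transfers D D1 a b -> b != a -> outdegree D1 b = (outdegree D b).+1.
Proof. by move=> /(_ b) + /negPf ba; rewrite eqxx ba addn0 addn1. Qed.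

Lemma transfers_other (G : multigraph) (D D1 : orientation G) a b x :
  transfers D D1 a b -> x != a -> x != b -> outdegree D1 x = outdegree D x.
Proof. by move=> /(_ x) + /negPf xa /negPf xb; rewrite xa xb !addn0. Qed.

Lemma transfers_refl (G : multigraph) (D D1 : orientation G) a x :
  transfers D D1 a a -> outdegree D1 x = outdegree D x.
Proof. by move=> /(_ x)/addIn. Qed.

Lemma transfers_flip1 (G : multigraph) (D : orientation G) e :
  transfers D (flip D (pred1 e)) (tail D e) (Defs.head D e).
Proof.
move=> x; rewrite !outdegreeE (bigD1 e) //= [in RHS](bigD1 e) //= eqxx.
rewrite (eq_bigr (fun i => (x == tail D i) : nat)); first by lia.
by move=> i /negPf ->.
Qed.

Lemma outdegree_flipT (G : multigraph) (D : orientation G) x :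
  outdegree (flip D predT) x + outdegree D x = degree x.
Proof.
rewrite !outdegreeE /degree -sum1_card [RHS]big_mkcond -big_split /=.
apply: eq_bigr => e _; rewrite inE (ends_tail_head D) !inE.
have := tail_neq_head D e; case: (eqVneq x (tail D e)) => [->|_].
  by move/negPf ->.
by rewrite addn0 => _; case: eqP.
Qed.

Lemma outdegree_le_degree (G : multigraph) (D : orientation G) x :
  outdegree D x <= degree x.
Proof. by rewrite -(outdegree_flipT D) leq_addl. Qed.

(** Reversing a simple path moves one unit of outdegree from its first to its
last vertex.  The second conclusion allows a further edge, out of the last vertex
or out of a vertex off the path, to be reversed afterwards. *)
Lemma reverse_path (G : multigraph) (D : orientation G) v p :
  path (arc D) v p -> uniq (v :: p) ->
  exists D1 : orientation G,
    transfers D D1 v (last v p) /\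
    (forall e, tail D e \notin belast v p ->
       tail D1 e = tail D e /\ Defs.head D1 e = Defs.head D e).
Proof.
(* The path is reversed from its far end: edges out of [v] are untouched when
   the first edge is reached, since [v] does not occur later on the path. *)
elim: p v => [|u p IHp] v /=; first by exists D.
case/andP=> /existsP[e /andP[/eqP te /eqP he]] pathp /andP[vNup uniqp].
have [D1 [outD1 keepD1]] := IHp u pathp uniqp.
have vNbelast : v \notin belast u p.
  by apply: contra vNup => /mem_belast.
have [te1 he1] : tail D1 e = v /\ Defs.head D1 e = u.
  by rewrite -te -he; apply: keepD1; rewrite te.
exists (flip D1 (pred1 e)); split=> [x|f].
  by have := transfers_flip1 D1 e x; have := outD1 x; rewrite te1 he1; lia.
rewrite inE negb_or => /andP[tNv tNbelast]; have [<- <-] := keepD1 f tNbelast.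
rewrite /=; case: eqP => // fe.
by move: tNv; rewrite fe te eqxx.
Qed.

(** * A lasso in a finite directed graph *)

(** A simple path that cannot be prolonged to a simple path must run back into
itself, as its last vertex has a successor. *)
Lemma lasso (T : finType) (r : rel T) v :
  (forall u, connect r v u -> exists y, r u y) ->
  exists p, [/\ path r v p, uniq (v :: p)
              & exists2 y, y \in v :: p & r (last v p) y].
Proof.
move=> succ; apply: contrapT => Nlasso.
have grow n : exists p, [/\ path r v p, uniq (v :: p) & size p = n].
  elim: n => [|n [p [pathp uniqp sizep]]]; first by exists [::].
  have [|y ry] := succ (last v p); first by apply/connectP; exists p.
  exists (rcons p y); rewrite rcons_path pathp ry size_rcons sizep.
  split=> //; rewrite -rcons_cons rcons_uniq uniqp andbT.
  by apply/negP => yp; apply: Nlasso; exists p; split=> //; exists y.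
have [p [_ uniqp sizep]] := grow #|T|.
by have := uniq_leq_size uniqp (fun x _ => mem_enum T x);
   rewrite -cardE /= sizep ltnn.
Qed.

(** * Orientations of minimal total cost *)

Definition total_cost (G : multigraph) (bad : vertex G -> pred nat)
    (D : orientation G) : nat :=
  \sum_v cost (bad v) (outdegree D v).

Lemma total_cost_transfer (G : multigraph) (bad : vertex G -> pred nat)
    (D D1 : orientation G) a b :
  a != b -> transfers D D1 a b ->
  total_cost bad D1 + cost (bad a) (outdegree D a)
    + cost (bad b) (outdegree D b) =
  total_cost bad D + cost (bad a) (outdegree D a).-1
    + cost (bad b) (outdegree D b).+1.
Proof.
move=> aDb out1; have bDa : b != a by rewrite eq_sym.
rewrite /total_cost (bigD1 a) //= (bigD1 b) //=.
rewrite [in RHS](bigD1 a) //= [in RHS](bigD1 b) //=.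
rewrite (transfers_source out1 aDb) (transfers_target out1 bDa).
rewrite (eq_bigr (fun i => cost (bad i) (outdegree D i))); first by lia.
by move=> i /andP[iDa iDb]; rewrite (transfers_other out1).
Qed.

(** Reversing a path from [v] to [u] saves 2 at [v], so by minimality it must cost
at least 2 at [u]; only a step from an allowed to a forbidden value does. *)
Lemma descendant_top_of_home (G : multigraph) (bad : vertex G -> pred nat)
    (D : orientation G) (v u : vertex G) :
  (forall x, spaced (degree x) (bad x)) ->
  (forall D1, total_cost bad D <= total_cost bad D1) ->
  bad v (outdegree D v) -> ~~ bad v (outdegree D v).-1 ->
  connect (arc D) v u -> u != v ->
  ~~ bad u (outdegree D u) /\ bad u (outdegree D u).+1.
Proof.
move=> sp minD badv Nbadv /connectP[p0 pathp0 ->].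
case: (shortenP pathp0) => p pathp uniqp _ uDv.
have [D1 [out1 _]] := reverse_path pathp uniqp.
move: (last v p) uDv out1 => w wDv out1.
have vDw : v != w by rewrite eq_sym.
have := total_cost_transfer bad vDw out1.
have [-> ->] := cost_bottom_of_hole (sp v) badv Nbadv.
by have := minD D1 => *; apply: cost_jump; lia.
Qed.

(** Reversing the handle of a lasso at [v], and then the edge that closes it, would
lower the total cost. *)
Lemma minimal_no_bottom_of_hole (G : multigraph) (bad : vertex G -> pred nat)
    (D : orientation G) (v : vertex G) :
  (forall x, spaced (degree x) (bad x)) ->
  (forall D1, total_cost bad D <= total_cost bad D1) ->
  bad v (outdegree D v) -> bad v (outdegree D v).-1.
Proof.
move=> sp minD badv; apply/negPn/negP => Nbadv.
have top u : connect (arc D) v u -> u != v ->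
    ~~ bad u (outdegree D u) /\ bad u (outdegree D u).+1.
  exact: descendant_top_of_home.
have [|p [pathp uniqp [y yp arcy]]] := @lasso _ (arc D) v.
  move=> u vu; apply: outdegree_gt0; case: (eqVneq u v) => [->|uDv].
    by have [/(_ _ badv)] := sp v; lia.
  have [Nbadu badu] := top _ vu uDv.
  by have [] := cost_top_of_home (sp u) Nbadu badu.
have yDl : last v p != y.
  by apply: contraTneq arcy => ->; rewrite arc_irreflexive.
have vl : connect (arc D) v (last v p) by apply/connectP; exists p.
have lDv : last v p != v.
  apply: contraNneq yDl => lv; move: uniqp yp lv; case: (p) => [|x q].
    by rewrite inE => _ /eqP ->.
  by case/andP=> vNq _ _ /= lv; have := mem_last x q; rewrite lv (negPf vNq).
have [Nbadl badl] := top _ vl lDv.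
have [l0 costl costl1 _] := cost_top_of_home (sp _) Nbadl badl.
move: pathp uniqp arcy yDl vl lDv Nbadl badl l0 costl costl1.
case/splitPl: yp => p1 p2 lastp1; rewrite cat_path last_cat lastp1.
set l := last y p2 => /andP[pathp1 _] uniqp /existsP[e /andP[/eqP te /eqP he]].
move=> lDy vl lDv Nbadl badl l0 costl costl1.
have p2l : l \in p2.
  have := mem_last y p2; rewrite -/l inE (negPf lDy) //.
move: uniqp; rewrite -cat_cons cat_uniq => /and3P[uniqp1 /hasPn disj _].
have lNp1 := disj _ p2l.
have [D1 [out1 keep1]] := reverse_path pathp1 uniqp1.
have [|te1 he1] := keep1 e.
  by rewrite te; apply: contra lNp1 => /mem_belast.
rewrite lastp1 te he in out1 te1 he1.
have outl : outdegree D1 l = outdegree D l by rewrite (transfers_other out1).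
have [costv costv1] := cost_bottom_of_hole (sp v) badv Nbadv.
(* If the closing edge returns to [v] itself, the handle is empty and reversing it
   changes no outdegree. *)
have [eqD1 costy] : total_cost bad D1 = total_cost bad D /\
    cost (bad y) (outdegree D1 y) = 3.
  have [yv | yDv] := eqVneq y v.
    have outE x : outdegree D1 x = outdegree D x.
      by rewrite yv in out1; apply: transfers_refl out1.
    rewrite outE yv costv; split; last by [].
    by apply: eq_bigr => x _; rewrite outE.
  have vDy : v != y by rewrite eq_sym.
  have vy : connect (arc D) v y by apply/connectP; exists p1.
  have [Nbady bady] := top _ vy yDv.
  have [_ costy _ costyS] := cost_top_of_home (sp _) Nbady bady.
  rewrite (transfers_target out1 yDv); split; last exact: costyS.
  have := total_cost_transfer bad vDy out1.
  rewrite costv costv1 costy costyS -!addnA.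
  exact: addIn.
have out2 : transfers D1 (flip D1 (pred1 e)) l y.
  by have := transfers_flip1 D1 e; rewrite te1 he1.
have := total_cost_transfer bad lDy out2.
rewrite outl eqD1 costl costl1 costy.
move: (cost_le3 (bad y) (outdegree D1 y).+1) (minD (flip D1 (pred1 e))).
by clear; lia.
Qed.

(** Reversing all edges preserves minimality and exchanges the two ends of a hole.
So a forbidden outdegree would have forbidden values both below and above it,
that is, two forbidden values at distance 2. *)
Lemma minimal_avoids (G : multigraph) (bad : vertex G -> pred nat)
    (D : orientation G) (v : vertex G) :
  (forall x, spaced (degree x) (bad x)) ->
  (forall D1, total_cost bad D <= total_cost bad D1) ->
  ~~ bad v (outdegree D v).
Proof.
move=> sp minD; apply/negP => badv.
have badP := minimal_no_bottom_of_hole sp minD badv.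
pose bad' x := mirror (degree x) (bad x).
have sp' x : spaced (degree x) (bad' x) by apply: spaced_mirror.
have outT D1 x : outdegree (flip D1 predT) x = degree x - outdegree D1 x.
  by have := outdegree_flipT D1 x; lia.
have costT D1 : total_cost bad' (flip D1 predT) = total_cost bad D1.
  apply: eq_bigr => x _; rewrite outT cost_mirror ?leq_subr //.
  by rewrite subKn // outdegree_le_degree.
have costT' D1 : total_cost bad (flip D1 predT) = total_cost bad' D1.
  by apply: eq_bigr => x _; rewrite outT cost_mirror // outdegree_le_degree.
have minD' D1 : total_cost bad' (flip D predT) <= total_cost bad' D1.
  by rewrite costT -costT'.
have badv' : bad' v (outdegree (flip D predT) v).
  by rewrite /bad' /mirror outT leq_subr subKn // outdegree_le_degree.
have := minimal_no_bottom_of_hole sp' minD' badv'.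
have [/(_ _ badv) [gt1 led] sep] := sp v.
rewrite /bad' /mirror outT => /andP[_ badS].
by have := sep _ _ badP badS; lia.
Qed.

Lemma orientation_exists (G : multigraph) : inhabited (orientation G).
Proof.
have endsP (e : edge G) : exists xy : vertex G * vertex G,
    ends e = [set xy.1; xy.2]%SET.
  have /eqP/cards2P[x [y [_ ->]]] := card_ends e.
  by exists (x, y).
have [f fP] := fin_all_exists endsP.
by exists; exact: (Orientation fP).
Qed.

Lemma minimal_exists (G : multigraph) (bad : vertex G -> pred nat) :
  exists D : orientation G,
    forall D1, total_cost bad D <= total_cost bad D1.
Proof.
have [D0] := orientation_exists G.
pose P n := `[< exists D : orientation G, total_cost bad D = n >].
have exP : exists n, P n.
  by exists (total_cost bad D0); apply/asboolP; exists D0.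
case: (ex_minnP exP) => n /asboolP[D <-] minD.
by exists D => D1; apply: minD; apply/asboolP; exists D1.
Qed.

(** * From holes and homes to spacing *)

Lemma interval_convex n (I : {set 'I_n}) (i j k : 'I_n) :
  is_interval I -> i \in I -> j \in I -> i <= k <= j -> k \in I.
Proof.
case/existsP=> a /existsP[b /andP[_ /eqP->]]; rewrite !inE.
by lia.
Qed.

Lemma is_interval1 n (i : 'I_n) : is_interval [set i]%SET.
Proof.
apply/existsP; exists i; apply/existsP; exists i; rewrite leqnn /=.
by apply/eqP/setP => k; rewrite !inE -eqn_leq eq_sym.
Qed.

Lemma hole_cover (G : multigraph) (F : vertex G -> set nat) (v : vertex G)
    (i : 'I_(degree v).+1) :
  i \in forbidden F v -> exists2 I, is_hole F I & i \in I.
Proof.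
move=> Fi.
have [|I holeI iI] := @maxset_exists _
  (fun J => is_interval J && (J \subset forbidden F v)) [set i]%SET.
  by rewrite is_interval1 finset.sub1set.
by exists I; rewrite // -finset.sub1set.
Qed.

Lemma home_cover (G : multigraph) (F : vertex G -> set nat) (v : vertex G)
    (i : 'I_(degree v).+1) :
  i \notin forbidden F v -> exists2 I, is_home F I & i \in I.
Proof.
move=> Fi.
have [|I homeI iI] := @maxset_exists _
  (fun J => is_interval J && [disjoint J & forbidden F v]) [set i]%SET.
  by rewrite is_interval1 disjoints1.
by exists I; rewrite // -finset.sub1set.
Qed.

(** The end-interval containing the extreme value [i] is a home with a second
element [k], and being an interval it contains every [j] between [i] and [k].
Used with [i] the least or the greatest value, and [j] equal or next to [i]. *)
Lemma end_neighbour_allowed (G : multigraph) (F : vertex G -> set nat)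
    (v : vertex G) (i j : 'I_(degree v).+1) :
  (forall I : {set 'I_(degree v).+1},
    is_end_interval F I -> is_home F I /\ 2 <= #|I|) ->
  (i == ord0) || (i == ord_max) ->
  (forall k, k != i -> i <= j <= k \/ k <= j <= i) ->
  j \notin forbidden F v.
Proof.
move=> end_homes endi betw.
have in_end (I : {set 'I_(degree v).+1}) :
    i \in I -> (ord0 \in I) || (ord_max \in I).
  by case/orP: endi => /eqP -> ->; rewrite ?orbT.
have [I homeI iI] : exists2 I, is_home F I & i \in I.
  have [Fi | NFi] := boolP (i \in forbidden F v); last exact: home_cover.
  have [I holeI iI] := hole_cover Fi; exists I => //.
  by have [] := end_homes I; rewrite // /is_end_interval holeI in_end.
have [_ card2] : is_home F I /\ 2 <= #|I|.
  by apply: end_homes; rewrite /is_end_interval homeI orbT in_end.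
have [k kI kDi] : exists2 k, k \in I & k != i.
  move: card2; rewrite (cardsD1 i) iI add1n ltnS => /card_gt0P[k].
  by rewrite !inE => /andP[kDi kI]; exists k.
have /maxsetp/andP[intI disjI] := homeI.
suff jI : j \in I by rewrite (disjointFr disjI).
by case: (betw k kDi); apply: interval_convex.
Qed.

(** Two forbidden values at distance 2 or 3 cannot lie in one hole, which would
then have at least three elements, nor in distinct holes, since the home between
these would fit into the at most two values strictly between them. *)
Lemma spaced_forbidden (G : multigraph) (F : vertex G -> set nat)
    (v : vertex G) :
  (forall I : {set 'I_(degree v).+1}, is_hole F I -> #|I| <= 2) ->
  (forall I J : {set 'I_(degree v).+1},
    is_hole F I -> is_hole F J -> I <> J ->
    exists H : {set 'I_(degree v).+1},
      [/\ is_home F H, between H I J & 3 <= #|H|]) ->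
  (forall I : {set 'I_(degree v).+1},
    is_end_interval F I -> is_home F I /\ 2 <= #|I|) ->
  spaced (degree v) (fun k => (k <= degree v) && (k \in F v)).
Proof.
move=> hole_size home_between end_homes.
have forbP k : (k <= degree v) && (k \in F v) ->
    exists2 i : 'I_(degree v).+1, i = k :> nat & i \in forbidden F v.
  case/andP=> lek Fk; exists (Ordinal (lek : k < (degree v).+1)) => //.
  by rewrite inE.
split=> [_ /forbP[i <- Fi] | _ _ /forbP[i <- Fi] /forbP[j <- Fj] ltij].
  split.
    rewrite ltnNge; apply/negP => i1.
    have := @end_neighbour_allowed _ F v ord0 i end_homes.
    rewrite Fi eqxx => /(_ isT _)/negP[] // k; rewrite -val_eqE /=; lia.
  rewrite leqNgt; apply/negP => id.
  have := @end_neighbour_allowed _ F v ord_max i end_homes.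
  rewrite Fi eqxx orbT => /(_ isT _)/negP[] // k.
  have := ltn_ord k; have := ltn_ord i; rewrite -val_eqE /=; lia.
case: (ltnP j (i + 4)) => [ltj4|]; last by right.
have [I holeI iI] := hole_cover Fi; have [J holeJ jJ] := hole_cover Fj.
left; apply/eqP; rewrite eqn_leq ltij andbT leqNgt; apply/negP => gtj.
have ltd : i.+1 < (degree v).+1 by apply: leq_ltn_trans (ltn_ord j); lia.
have [eqIJ | neqIJ] := eqVneq I J.
  have /maxsetp/andP[intI _] := holeI.
  have jI : j \in I by rewrite eqIJ.
  have mI : Ordinal ltd \in I.
    by apply: (interval_convex intI iI jI) => /=; lia.
  have := hole_size I holeI; apply/negP; rewrite -ltnNge.
  rewrite (cardsD1 i) iI (cardsD1 j) (cardsD1 (Ordinal ltd)).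
  by rewrite !inE jI mI -!val_eqE /=; lia.
have [|H [_ btw card3]] := home_between I J holeI holeJ; first exact/eqP.
have btwH h : h \in H -> i < h < j.
  move=> hH; case: btw => -[pIH pHJ].
    by rewrite (pIH i h) // (pHJ h j).
  by have := pIH j h jJ hH; have := pHJ h i hH iI; lia.
have ltd2 : i.+2 < (degree v).+1 by apply: leq_ltn_trans (ltn_ord j); lia.
suff /subset_leq_card : H \subset [set Ordinal ltd; Ordinal ltd2]%SET.
  by rewrite cards2; case: (_ != _); lia.
apply/fintype.subsetP => h /btwH; rewrite !inE -!val_eqE /=; lia.
Qed.

Theorem theorem6 (G : multigraph) (F : vertex G -> set nat)
  (hole_size : forall (v : vertex G) (I : {set 'I_(degree v).+1}),
    is_hole F I -> #|I| <= 2)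
  (home_between : forall (v : vertex G) (I J : {set 'I_(degree v).+1}),
    is_hole F I -> is_hole F J -> I <> J ->
    exists H : {set 'I_(degree v).+1},
      [/\ is_home F H, between H I J & 3 <= #|H|])
  (end_homes : forall (v : vertex G) (I : {set 'I_(degree v).+1}),
    is_end_interval F I -> is_home F I /\ 2 <= #|I|) :
  exists D : orientation G, avoiding F D.
Proof.
pose bad v k := (k <= degree v) && (k \in F v).
have sp v : spaced (degree v) (bad v).
  apply: spaced_forbidden; first exact: hole_size.
    exact: home_between.
  exact: end_homes.
have [D minD] := minimal_exists bad.
exists D => v; have := minimal_avoids v sp minD.
by rewrite /bad outdegree_le_degree.
Qed.
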